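(* Let $T$ be a tree on $n$ vertices with $p$ leaves, and let $B$ be a basis of the row space of $\mathfrak{D}_2(T)$ of the following form: letting $B_1,\dots,B_{n-p}$ be the blocks of the line graph $\mathrm{LG}(T)$, choose for each $j$ an edge $f'_j$ of $\mathrm{LG}(T)$ lying in $B_j$ (so $f'_j$ is a pair of edges of $T$ sharing a vertex), let $f_j$ be the symmetric difference of the endpoint sets of these two edges of $T$ (a 2-element vertex set), and set $B=\{e_1,\dots,e_{n-1},f_1,\dots,f_{n-p}\}$ where $e_1,\dots,e_{n-1}$ are the edges of $T$. Let $P=\mathfrak{D}_2(T)[B,B]$ and write $\det(xI-P)=\sum_{k=0}^{2n-p-1}a_kx^k$. Then the sequence $|a_0|,|a_1|,\ldots,|a_{2n-p-2}|$ is unimodal and log-concave.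
   Context: Let $\mathcal{V}_2$ be the set of 2-element subsets of the vertex set of $T$ (edges are regarded as elements of $\mathcal{V}_2$). The 2-Steiner distance matrix $\mathfrak{D}_2(T)$ is the $\binom n2\times\binom n2$ matrix indexed by $\mathcal{V}_2$ whose entry in row $\{i,j\}$ and column $\{k,l\}$ is the minimum number of edges of a connected subtree of $T$ whose vertex set contains $i,j,k,l$. $M[B,B]$ denotes the principal submatrix with rows and columns indexed by $B$. (Such a $B$ is a basis of the row space of $\mathfrak{D}_2(T)$, which has rank $2n-p-1$.) A sequence is unimodal if it weakly increases up to some index and weakly decreases afterwards; it is log-concave if $a_i^2\ge a_{i-1}a_{i+1}$ for all interior indices $i$. *)

(* Defs.v *)
From mathcomp Require Import all_boot all_order all_algebra.
Set Implicit Arguments. Unset Strict Implicit. Unset Printing Implicit Defensive.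
Import GRing.Theory Num.Theory.

(* Induced subgraph of r on S is connected (the empty set counts as connected). *)
Definition connected_on (T : finType) (r : rel T) (S : {set T}) : bool :=
  [forall x in S, forall y in S,
    connect [rel u v | [&& u \in S, v \in S & r u v]] x y].

Definition simple_graph (T : finType) (r : rel T) : Prop :=
  irreflexive r /\ symmetric r.

Definition is_tree (n : nat) (adj : rel 'I_n) : Prop :=
  [/\ simple_graph adj, connected_on adj [set: 'I_n] &
      forall c : seq 'I_n, 3 <= size c -> uniq c -> ~~ cycle adj c].

Definition tedges (n : nat) (adj : rel 'I_n) : {set {set 'I_n}} :=
  [set [set x.1; x.2] | x in [set x : 'I_n * 'I_n | adj x.1 x.2]].

Definition nleaves (n : nat) (adj : rel 'I_n) : nat :=
  #|[set v : 'I_n | #|[set u | adj v u]| == 1]|.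

Definition lgraph (n : nat) (adj : rel 'I_n) : rel {set 'I_n} :=
  fun e e' => [&& e \in tedges adj, e' \in tedges adj, e != e' & e :&: e' != set0].

Definition conn_nocut (T : finType) (V : {set T}) (r : rel T) (S : {set T}) : bool :=
  [&& S \subset V, S != set0, connected_on r S &
      [forall x in S, connected_on r (S :\ x)]].

Definition is_block (T : finType) (V : {set T}) (r : rel T) (S : {set T}) : bool :=
  conn_nocut V r S &&
  [forall S' : {set T}, (S \subset S') && conn_nocut V r S' ==> (S' == S)].

(* 2-Steiner distance between two vertex sets A, B: minimum number of edges of a
   connected subtree whose vertex set contains A :|: B. (Subtrees of a tree are
   induced, so edges of the subtree are the tree edges inside its vertex set.) *)
Definition steiner2 (n : nat) (adj : rel 'I_n) (A B : {set 'I_n}) : nat :=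
  \big[minn/n]_(S : {set 'I_n} | (A :|: B \subset S) && connected_on adj S)
     #|[set e in tedges adj | e \subset S]|.

Definition steiner_sub (n : nat) (adj : rel 'I_n) (B : {set {set 'I_n}})
  : 'M[int]_#|B| :=
  \matrix_(i, j) (Posz (steiner2 adj (enum_val i) (enum_val j))).

Definition symdiff (T : finType) (A B : {set T}) : {set T} := (A :\: B) :|: (B :\: A).

Definition unimodal (s : seq nat) : Prop :=
  exists m, forall i j, i <= j < size s ->
    (j <= m -> nth 0 s i <= nth 0 s j) /\ (m <= i -> nth 0 s j <= nth 0 s i).

Definition log_concave (s : seq nat) : Prop :=
  forall i, 0 < i -> i.+1 < size s -> nth 0 s i.-1 * nth 0 s i.+1 <= nth 0 s i ^ 2.

(* Main.v *)
Require Import Defs.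
From mathcomp Require Import all_boot all_order all_algebra all_field.
From mathcomp Require Import ring zify.
Set Implicit Arguments. Unset Strict Implicit. Unset Printing Implicit Defensive.
Import Order.TTheory GRing.Theory Num.Theory.

(** Cutting an edge [uv] of the tree leaves two sides, and [uv] avoids the
    Steiner tree of [A] and [B] exactly when both sets lie on the same side.
    Counting edges gives [D(A, B) = (n - 1) - \sum_d w_d(A) w_d(B)], where [d]
    runs over the oriented edges and [w_d] indicates inclusion in the side of
    [d].  Hence [P] is a rank-one matrix minus a positive semidefinite one, so
    it has at most one positive eigenvalue [lam], and its trace is positive.

    Therefore [det (xI - P) = (x - lam) \prod (x + mu_i)] with [mu_i >= 0] and
    [lam > \sum mu_i = e_1], and up to sign the coefficients are
    [lam e_j - e_(j+1)].  For [Delta(i, k) = e_i e_k - e_(i-1) e_(k+1)] the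
    log-concavity defect is
    [lam (lam Delta(j, j) - Delta(j, j+1)) + Delta(j+1, j+1)], which is
    nonnegative because [e_1 Delta(i, k) >= Delta(i, k+1)] (Pieri's rule).
    The coefficients vanish only on an initial segment, so log-concavity gives
    unimodality.  Finally the star of each non-leaf vertex is a block of the
    line graph and these yield distinct non-edges [f_j], so [P] has size at
    least [2n - p - 1] and the leading coefficient [1] is not in the sequence. *)

(** * Elementary symmetric functions and their two-column minors *)

Section ElementarySymmetric.
Local Open Scope ring_scope.
Variable R : numDomainType.
Implicit Types (s : seq R) (i k z : int) (j : nat).

(* Indexing by [int] makes the Pascal recursion hold without boundary cases. *)
Fixpoint elsym s z : R :=
  if s is x :: s' then elsym s' z + x * elsym s' (z - 1) else (z == 0)%:R.

(* The Schur function of the two-column shape with columns k and i. *)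
Definition eminor s i k : R :=
  elsym s i * elsym s k - elsym s (i - 1) * elsym s (k + 1).

Lemma elsym_lt0 s z : z < 0 -> elsym s z = 0.
Proof.
elim: s z => [|x s IHs] z z_lt0 /=; first by case: eqP => //; lia.
by rewrite !IHs ?mulr0 ?addr0 //; lia.
Qed.

Lemma elsym_gt_size s z : (size s)%:Z < z -> elsym s z = 0.
Proof.
elim: s z => [|x s IHs] z /= z_gt; first by case: eqP => //; lia.
by rewrite !IHs ?mulr0 ?addr0 //; lia.
Qed.

Lemma elsym0 s : elsym s 0 = 1.
Proof.
by elim: s => //= x s ->; rewrite elsym_lt0 // mulr0 addr0.
Qed.

Lemma elsym1 s : elsym s 1 = \sum_(x <- s) x.
Proof.
elim: s => [|x s IHs]; first by rewrite big_nil.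
by rewrite big_cons /= IHs elsym0 mulr1 addrC.
Qed.

Lemma coef_prod_XDC s j :
  (\prod_(x <- s) ('X + x%:P))`_j = elsym s ((size s)%:Z - j%:Z).
Proof.
elim: s j => [|x s IHs] k.
  by rewrite big_nil coef1 /=; congr (nat_of_bool _)%:R; lia.
rewrite big_cons mulrDl coefD coefXM coefCM !IHs /=.
have -> : (size s).+1%:Z - k%:Z - 1 = (size s)%:Z - k%:Z by lia.
case: k => [|k] /=; last by congr (elsym s _ + _); lia.
by rewrite (@elsym_gt_size s ((size s).+1%:Z - _)) //; lia.
Qed.

Lemma elsym_ge0 s z : {in s, forall x, 0 <= x} -> 0 <= elsym s z.
Proof.
elim: s z => [|x s IHs] z s_ge0 /=; first exact: ler0n.
have t_ge0 : {in s, forall y, 0 <= y} by move=> y ys; rewrite s_ge0 ?inE ?ys ?orbT.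
by rewrite addr_ge0 ?mulr_ge0 ?IHs // s_ge0 ?mem_head.
Qed.

(** The branching rule for Schur functions: the power of [x] counts the boxes of a horizontal strip
    removed from the shape, at most one per column. *)
Lemma eminor_cons x s i k :
  eminor (x :: s) i k = eminor s i k
    + x * (eminor s i (k - 1) + eminor s (i - 1) k)
    + x ^+ 2 * eminor s (i - 1) (k - 1).
Proof. by rewrite /eminor /= addrK subrK; ring. Qed.

(** Induction by the branching rule. The range extends to [i = k + 1], where the minor vanishes
    identically, so that the pair [(i, k - 1)] arising from [i <= k] stays admissible. *)
Lemma eminor_ge0 s i k :
  {in s, forall x, 0 <= x} -> i <= k + 1 -> 0 <= eminor s i k.
Proof.
elim: s i k => [|x s IHs] i k s_ge0 le_ik.
  rewrite /eminor /= -!natrM !mulnb.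
  have -> : (i - 1 == 0) && (k + 1 == 0) = false by lia.
  by rewrite subr0 ler0n.
have x_ge0 : 0 <= x by rewrite s_ge0 ?mem_head.
have t_ge0 : {in s, forall y, 0 <= y} by move=> y ys; rewrite s_ge0 ?inE ?ys ?orbT.
have [->|neq_ik] := eqVneq i (k + 1).
  by rewrite /eminor addrK [X in X - _]mulrC subrr.
have h1 : 0 <= eminor s i k by apply: IHs.
have h2 : 0 <= eminor s i (k - 1) by apply: IHs => //; lia.
have h3 : 0 <= eminor s (i - 1) k by apply: IHs => //; lia.
have h4 : 0 <= eminor s (i - 1) (k - 1) by apply: IHs => //; lia.
rewrite eminor_cons; apply: addr_ge0; last by rewrite mulr_ge0 ?exprn_ge0.
by apply: addr_ge0 => //; apply: mulr_ge0 => //; apply: addr_ge0.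
Qed.

(* An instance of Pieri's rule: e_1 times the Schur function of columns (k, i)
   contains the Schur function of columns (k + 1, i). *)
Lemma eminor_pieri s i k :
  {in s, forall x, 0 <= x} -> i <= k ->
  eminor s i (k + 1) <= elsym s 1 * eminor s i k.
Proof.
elim: s i k => [|x s IHs] i k s_ge0 le_ik.
  rewrite /eminor /= mul0r -!natrM !mulnb.
  have -> : (i == 0) && (k + 1 == 0) = false by lia.
  by rewrite sub0r oppr_le0 ler0n.
have x_ge0 : 0 <= x by rewrite s_ge0 ?mem_head.
have t_ge0 : {in s, forall y, 0 <= y} by move=> y ys; rewrite s_ge0 ?inE ?ys ?orbT.
rewrite -subr_ge0 !eminor_cons addrK /= elsym0.
set e1 := elsym s 1.
have e1_ge0 : 0 <= e1 by apply: elsym_ge0.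
have h0 : 0 <= e1 * eminor s i k - eminor s i (k + 1) by rewrite subr_ge0 IHs.
have h1 : 0 <= e1 * eminor s (i - 1) k - eminor s (i - 1) (k + 1).
  by rewrite subr_ge0 IHs //; lia.
have h2 : 0 <= eminor s (i - 1) (k - 1) by apply: eminor_ge0 => //; lia.
have h3 : 0 <= eminor s i (k - 1) by apply: eminor_ge0 => //; lia.
have h4 : 0 <= eminor s (i - 1) k by apply: eminor_ge0 => //; lia.
set a := eminor s i k in h0 *; set b := eminor s i (k + 1) in h0 *.
set c := eminor s (i - 1) k in h1 h4 *; set d := eminor s (i - 1) (k + 1) in h1 *.
set f := eminor s (i - 1) (k - 1) in h2 *; set g := eminor s i (k - 1) in h3 *.
(* The terms [x * a] and [x ^+ 2 * c] cancel; each remaining coefficient of a power of [x] is a sum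
   of inductive Pieri differences and products of nonnegative quantities. *)
have -> : (e1 + x * 1) * (a + x * (g + c) + x ^+ 2 * f)
    - (b + x * (a + d) + x ^+ 2 * c)
  = (e1 * a - b) + x * ((e1 * c - d) + e1 * g) + x ^+ 2 * (e1 * f + g)
    + x ^+ 3 * f by ring.
apply: addr_ge0; last by rewrite mulr_ge0 ?exprn_ge0.
apply: addr_ge0; last by rewrite mulr_ge0 ?exprn_ge0 // addr_ge0 // mulr_ge0.
by rewrite (addr_ge0 h0) // mulr_ge0 // (addr_ge0 h1) // mulr_ge0.
Qed.

(** * Coefficients of a real-rooted polynomial with a single, dominant positive root *)

Section OnePositiveRoot.
Variables (s : seq R) (lam : R).
Hypotheses (s_ge0 : {in s, forall x, 0 <= x}) (lam_gt : \sum_(x <- s) x < lam).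
Let q := ('X - lam%:P) * \prod_(x <- s) ('X + x%:P).
Let lam_gt0 : 0 < lam.
Proof. by apply: le_lt_trans lam_gt; rewrite -elsym1 elsym_ge0. Qed.

Lemma coef_one_pos_root j :
  q`_j = elsym s ((size s)%:Z - j%:Z + 1) - lam * elsym s ((size s)%:Z - j%:Z).
Proof.
rewrite /q mulrBl coefB coefCM coefXM !coef_prod_XDC.
case: j => [|j] /=; last by congr (elsym s _ - _); lia.
by rewrite (@elsym_gt_size s (_ + 1)) //; lia.
Qed.

(** Pieri's rule for an empty second column, where the minor reduces to [elsym s z]. *)
Lemma elsym_succ_le z : 0 <= z -> elsym s (z + 1) <= elsym s 1 * elsym s z.
Proof.
move=> z_ge0; have := @eminor_pieri s 0 z s_ge0 z_ge0.
by rewrite /eminor elsym0 !(@elsym_lt0 s (0 - 1)) // !mul0r !subr0 !mul1r.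
Qed.

Lemma coef_one_pos_root_le0 j : (j <= size s)%N -> q`_j <= 0.
Proof.
move=> le_js; rewrite coef_one_pos_root subr_le0.
apply: le_trans (elsym_succ_le _) _; first lia.
by rewrite ler_wpM2r ?elsym_ge0 // elsym1 ltW.
Qed.

(** If e_z = lam e_(z-1), then e_z <= e_1 e_(z-1) and e_1 < lam force e_(z-1) = 0. Hence e_z = 0,
    and e_(z+1) <= e_1 e_z vanishes too. *)
Lemma coef_one_pos_root_eq0 j : (j < size s)%N -> q`_j.+1 = 0 -> q`_j = 0.
Proof.
rewrite !coef_one_pos_root => lt_js /eqP; rewrite subr_eq0 => /eqP eq_q.
set z := ((size s)%:Z - j%:Z)%R.
have ez : (size s)%:Z - j.+1%:Z = z - 1 by lia.
rewrite {}ez subrK in eq_q.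
have z0 : elsym s (z - 1) = 0.
  apply/eqP; move: (elsym_ge0 (z - 1) s_ge0); rewrite le_eqVlt eq_sym.
  case/orP => // e_gt0.
  have z1_ge0 : 0 <= z - 1 by lia.
  by have := elsym_succ_le z1_ge0; rewrite subrK eq_q ler_pM2r // elsym1 lt_geF.
have e0 : elsym s z = 0 by rewrite eq_q z0 mulr0.
apply/eqP; rewrite e0 mulr0 subr0 eq_le elsym_ge0 // andbT.
by apply: le_trans (elsym_succ_le _) _; [lia | rewrite e0 mulr0].
Qed.

Lemma coef_one_pos_root_log_concave j : (j.+1 < size s)%N ->
  q`_j * q`_j.+2 <= q`_j.+1 ^+ 2.
Proof.
move=> lt_js; rewrite !coef_one_pos_root.
set z := (size s)%:Z - j.+1%:Z.
have -> : (size s)%:Z - j%:Z = z + 1 by lia.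
have -> : (size s)%:Z - j.+2%:Z = z - 1 by lia.
rewrite subrK -subr_ge0.
have -> : (elsym s (z + 1) - lam * elsym s z) ^+ 2 -
   (elsym s (z + 1 + 1) - lam * elsym s (z + 1)) *
   (elsym s z - lam * elsym s (z - 1))
   = lam * (lam * eminor s z z - eminor s z (z + 1)) + eminor s (z + 1) (z + 1).
  by rewrite /eminor addrK; ring.
have le_e : elsym s 1 <= lam by rewrite elsym1 ltW.
rewrite addr_ge0 ?mulr_ge0 ?eminor_ge0 ?(ltW lam_gt0) ?subr_ge0 //; last lia.
apply: le_trans (eminor_pieri s_ge0 (lexx z)) _.
by rewrite ler_wpM2r // eminor_ge0 //; lia.
Qed.

End OnePositiveRoot.
End ElementarySymmetric.

(** * From log-concavity to unimodality *)

Lemma log_concave_unimodal (s : seq nat) :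
  (forall i, i.+1 < size s -> nth 0 s i.+1 = 0 -> nth 0 s i = 0) ->
  log_concave s -> unimodal s.
Proof.
set f := nth 0 s => f0 f_lc.
(* Since zeros propagate to smaller indices, a strict descent ends at a positive value, and
   log-concavity then makes the next step a strict descent as well. *)
have descent i : i.+2 < size s -> f i.+1 < f i -> f i.+2 < f i.+1.
  move=> lt_is lt_f; have /= := f_lc i.+1 isT lt_is; rewrite -/f.
  have : f i.+1 = 0 -> f i = 0 by apply: f0; lia.
  by nia.
pose d i := (i.+1 < size s) && (f i.+1 < f i).
(* The mode is the index of the first strict descent, or [size s] when there is none. *)
have [/hasP ex_d|no_d] := boolP (has d (iota 0 (size s))); last first.
  exists (size s) => i j /andP[le_ij lt_js]; split=> [_|]; last by lia.
  elim: j le_ij lt_js => [|j IHj] le_ij lt_js; first by move: le_ij; rewrite leqn0 =>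
      /eqP->.
  have [->//|neq] := eqVneq i j.+1.
  apply: leq_trans (IHj _ _) _; [lia | lia|].
  move/hasPn/(_ j): no_d; rewrite mem_iota /d -/f; lia.
have ex_d' : exists i, d i by case: ex_d => i _; exists i.
case: (ex_minnP ex_d') => m /andP[lt_ms d_m] min_m.
exists m => i j /andP[le_ij lt_js]; split=> [le_jm|le_mi].
  elim: j le_ij lt_js le_jm => [|j IHj] le_ij lt_js le_jm.
    by move: le_ij; rewrite leqn0 => /eqP->.
  have [->//|neq] := eqVneq i j.+1.
  apply: leq_trans (IHj _ _ _) _; [lia | lia | lia|].
  by move: (min_m j); rewrite /d -/f; lia.
have dec k : m + k.+1 < size s -> f (m + k.+1) < f (m + k).
  elim: k => [|k IHk] lt_k; first by rewrite addn0 addn1.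
  by rewrite !addnS; apply: descent; rewrite -?addnS ?IHk; lia.
elim: j le_ij lt_js => [|j IHj] le_ij lt_js; first by move: le_ij; rewrite leqn0 =>
    /eqP->.
have [->//|neq] := eqVneq i j.+1.
apply: leq_trans (IHj _ _); [|lia | lia].
have := dec (j - m); rewrite addnS subnKC; last lia.
by move=> /(_ lt_js)/ltnW.
Qed.

(** * Spectrum of a constant matrix minus a Gram matrix *)

Section OnePositiveEigenvalue.
Local Open Scope ring_scope.
Local Open Scope sesquilinear_scope.

Lemma char_poly_similar (R : comUnitRingType) n (U A : 'M[R]_n) :
  U \in unitmx -> char_poly (invmx U *m A *m U) = char_poly A.
Proof.
move=> Uunit; rewrite /char_poly /char_poly_mx.
set V := map_mx polyC U; set W := map_mx polyC (invmx U).
have WV : W *m V = 1%:M by rewrite -map_mxM mulVmx // map_mx1.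
have -> : 'X%:M - map_mx polyC (invmx U *m A *m U)
    = W *m ('X%:M - map_mx polyC A) *m V.
  by rewrite mulmxBr mulmxBl !map_mxM (scalar_mxC _ W) -(mulmxA _ W) WV mulmx1.
by rewrite !det_mulmx mulrAC -det_mulmx WV det1 mul1r.
Qed.

Variables (C : numClosedFieldType) (N : nat) (A : 'M[C]_N).
Variables (I : finType) (c : C) (w : I -> 'I_N -> C).
Hypotheses (w_real : forall t i, w t i \is Num.real) (c_real : c \is Num.real).
Hypothesis A_eq : forall i j, A i j = c - \sum_t w t i * w t j.

Lemma sub_rank1_hermitian : A \is hermsymmx.
Proof.
apply: realsym_hermsym; last first.
  apply/mxOverP => i j; rewrite A_eq rpredB ?rpred_sum // => t _.
  exact: rpredM.
rewrite qualifE /= expr0 scale1r; apply/eqP/matrixP => i j; rewrite !mxE !A_eq.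
by congr (c - _); apply: eq_bigr => t _; rewrite mulrC.
Qed.

(** The constant part of [A] dies on vectors of coordinate sum zero, leaving minus a sum of squared
    moduli. *)
Lemma sub_rank1_form_le0 (y : 'rV[C]_N) :
  \sum_i y 0 i = 0 -> (y *m A *m y^t*) 0 0 <= 0.
Proof.
move=> y0.
have -> : (y *m A *m y^t*) 0 0 = - \sum_t `|\sum_i y 0 i * w t i| ^+ 2.
  rewrite mxE.
  under eq_bigr => j _.
    rewrite !mxE.
    under eq_bigr do rewrite A_eq mulrBr mulr_sumr.
    rewrite sumrB -mulr_suml y0 mul0r sub0r mulNr exchange_big /= mulr_suml.
    over.
  rewrite sumrN exchange_big /=; congr (- _); apply: eq_bigr => t _.
  rewrite normCK rmorph_sum /= mulr_sumr; apply: eq_bigr => j _.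
  rewrite rmorphM /= (CrealP (w_real t j)).
  under eq_bigr do rewrite mulrA.
  by rewrite -mulr_suml mulrCA mulrA mulrC mulrA.
by rewrite oppr_le0 sumr_ge0 // => t _; rewrite exprn_ge0.
Qed.

Let U := spectralmx A.
Let D := spectral_diag A.

Let UAU : U *m A *m U^t* = diag_mx D.
Proof.
have /hermitian_normalmx/orthomx_spectralP {1}-> := sub_rank1_hermitian.
by rewrite -/U -/D !mulmxA mulmxV ?spectral_unit // mul1mx mulmxtVK ?spectral_unitarymx.
Qed.

(** Two positive eigenvalues would give a plane on which the form is positive definite. Such a plane
    meets the hyperplane of coordinate sum zero, where the form is nonpositive. *)
Lemma spectral_diag_pos_unique i j :
  i != j -> 0 < D 0 i -> D 0 j <= 0.
Proof.
move=> neq_ij Di_gt0.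
have D_real k : D 0 k \is Num.real.
  by apply: (mxOverP (hermitian_spectral_diag_real sub_rank1_hermitian)).
rewrite real_leNgt ?rpred0 //; apply/negP => Dj_gt0.
pose s k := \sum_l U k l.
(* Coefficients of a nonzero combination of the two eigenvectors whose coordinates sum to zero. *)
have [a [b [ab_neq0 ab_s]]] : exists a b, (a != 0) || (b != 0) /\ a * s i + b * s j = 0.
  have [s0|s_neq0] := eqVneq (s i) 0.
    by exists 1, 0; rewrite oner_neq0 s0 mulr0 mul0r addr0.
  by exists (s j), (- s i); rewrite oppr_eq0 s_neq0 orbT mulNr mulrC subrr.
pose x : 'rV[C]_N := a *: delta_mx 0 i + b *: delta_mx 0 j.
have xU l : (x *m U) 0 l = a * U i l + b * U j l.
  by rewrite mulmxDl -!scalemxAl -!rowE !mxE.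
have := @sub_rank1_form_le0 (x *m U).
under eq_bigr do rewrite xU.
rewrite big_split -!mulr_sumr /= => /(_ ab_s).
have -> : x *m U *m A *m (x *m U)^t* = x *m diag_mx D *m x^t*.
  by rewrite -UAU trmx_mul map_mxM !mulmxA.
rewrite mxE (bigD1 i) //= (bigD1 j) 1?eq_sym //= big1 => [|k /andP[ki kj]]; last first.
  by rewrite mul_mx_diag !mxE (negPf ki) (negPf kj) !andbF /= !mulr0 addr0 !mul0r.
rewrite mul_mx_diag !mxE !eqxx (negPf neq_ij) eq_sym (negPf neq_ij) /=.
rewrite !mulr1 !mulr0 !addr0 add0r.
rewrite ![_ * D 0 _ * _]mulrAC -!normCK lt_geF //.
have pa : 0 <= `|a| ^+ 2 * D 0 i by rewrite mulr_ge0 ?exprn_ge0 // ltW.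
have pb : 0 <= `|b| ^+ 2 * D 0 j by rewrite mulr_ge0 ?exprn_ge0 // ltW.
rewrite lt_def paddr_eq0 // addr_ge0 // andbT negb_and.
by rewrite !mulf_eq0 !normr_eq0 (gt_eqF Di_gt0) (gt_eqF Dj_gt0) !orbF !orbb.
Qed.

(** A positive trace forces a positive eigenvalue [lam]. The list [s] holds the negatives of the
    others, and [lam] exceeds their sum precisely because the trace is positive. *)
Lemma char_poly_one_pos_root : 0 < \tr A ->
  exists (lam : C) (s : seq C), [/\ {in s, forall x, 0 <= x},
    \sum_(x <- s) x < lam, (size s).+1 = N &
    char_poly A = ('X - lam%:P) * \prod_(x <- s) ('X + x%:P)].
Proof.
have A_spec : A = invmx U *m diag_mx D *m U.
  exact/orthomx_spectralP/hermitian_normalmx/sub_rank1_hermitian.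
have Uunit : U \in unitmx by exact: spectral_unit.
have -> : \tr A = \sum_i D 0 i.
  rewrite A_spec -mulmxA mxtrace_mulC -mulmxA mulmxV // mulmx1.
  by apply: eq_bigr => i _; rewrite !mxE eqxx.
have D_real k : D 0 k \is Num.real.
  by apply: (mxOverP (hermitian_spectral_diag_real sub_rank1_hermitian)).
move=> tr_gt0.
have [i0 Di0] : exists i, 0 < D 0 i.
  apply/existsP; apply: contraLR tr_gt0 => /existsPn D_le0.
  by rewrite le_gtF // sumr_le0 // => i _; rewrite real_leNgt ?rpred0.
exists (D 0 i0), [seq - D 0 i | i <- enum (predC1 i0)]; split.
- move=> x /mapP[i]; rewrite mem_enum inE => neq_i ->.
  by rewrite oppr_ge0 (@spectral_diag_pos_unique i0) // eq_sym.
- rewrite big_map big_enum /= sumrN -subr_gt0 opprK.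
  by rewrite (bigD1 i0) //= in tr_gt0.
- rewrite size_map -cardE; have := cardC1 i0; rewrite card_ord => ->.
  by case: N i0 {Di0} => // -[].
- rewrite {1}A_spec char_poly_similar // char_poly_trig ?diag_mx_is_trig //.
  rewrite (bigD1 i0) //= mxE eqxx mulr1n; congr (_ * _).
  rewrite big_map big_enum /=; apply: eq_bigr => i _.
  by rewrite mxE eqxx mulr1n polyCN.
Qed.

End OnePositiveEigenvalue.

(** * Transfer to integer matrices *)

Section IntMatrix.
Local Open Scope ring_scope.

Lemma char_poly_coef_log_concave (N M : nat) (P : 'M[int]_N) (I : finType) (c : int)
    (w : I -> 'I_N -> int) :
  (forall i j, P i j = c - \sum_t w t i * w t j) -> 0 < \tr P -> (M <= N)%N ->
  let s := [seq absz (char_poly P)`_k | k <- iota 0 M] in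
  unimodal s /\ log_concave s.
Proof.
move=> P_eq tr_gt0 le_MN s.
(* The spectral theorem is applied over [algC]; the resulting facts on coefficients descend because
   the embedding of [int] reflects order and equality. *)
pose A := map_mx (intr : int -> algC) P.
have A_eq i j : A i j = c%:~R - \sum_t (w t i)%:~R * (w t j)%:~R.
  rewrite mxE P_eq rmorphB rmorph_sum; congr (_ - _).
  by apply: eq_bigr => t _; rewrite rmorphM.
have trA : 0 < \tr A by rewrite trace_map_mx ltr0z.
have := @char_poly_one_pos_root _ _ A _ _ _ (fun t i =>
    realz _ (w t i)) (realz _ c) A_eq trA.
case=> lam [mu [mu_ge0 lam_gt size_mu chA]].
rewrite -map_char_poly /= in chA.
set q := char_poly P in chA s *.
have q_le0 k : (k < N)%N -> q`_k <= 0.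
  rewrite -size_mu ltnS => /(coef_one_pos_root_le0 mu_ge0 lam_gt).
  by rewrite -chA coef_map /= lerz0.
have q_eq0 k : (k.+1 < N)%N -> q`_k.+1 = 0 -> q`_k = 0.
  rewrite -size_mu ltnS => /(coef_one_pos_root_eq0 mu_ge0 lam_gt).
  rewrite -chA !coef_map /= => q0 qk; apply/eqP; rewrite -(intr_eq0 algC).
  by apply/eqP/q0; rewrite qk.
have q_lc k : (k.+2 < N)%N -> q`_k * q`_k.+2 <= q`_k.+1 ^+ 2.
  rewrite -size_mu ltnS => /(coef_one_pos_root_log_concave mu_ge0 lam_gt).
  by rewrite -chA !coef_map /= -rmorphM -rmorphXn /= ler_int.
have size_s : size s = M by rewrite size_map size_iota.
have nth_s k : (k < M)%N -> nth 0%N s k = absz q`_k.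
  by move=> lt_kM; rewrite (nth_map 0%N) ?size_iota // nth_iota.
have s_lc : log_concave s.
  move=> [//|k] _; rewrite size_s => lt_kM; rewrite !nth_s /=; try lia.
  (* All coefficients below index [N] are nonpositive, so the product of two of them equals its
     absolute value. *)
  rewrite -abszM -abszX -lez_nat !gez0_abs ?sqr_ge0 //; first by apply: q_lc; lia.
  by rewrite mulr_le0 // q_le0 //; lia.
split=> //; apply: log_concave_unimodal s_lc => k; rewrite size_s => lt_kM.
rewrite (nth_s _ lt_kM) (nth_s _ (ltnW lt_kM)) => /eqP; rewrite absz_eq0 => /eqP.
by move/(q_eq0 _ (leq_trans lt_kM le_MN)) ->.
Qed.

End IntMatrix.

Lemma geq_bigmin (I : finType) (m : nat) (Q : pred I) (F : I -> nat) (i : I) :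
  Q i -> \big[minn/m]_(j | Q j) F j <= F i.
Proof.
move=> Qi; have := mem_index_enum i; elim: (index_enum I) => // j r IHr.
rewrite inE big_cons => /orP[/eqP<-|/IHr le_r]; first by rewrite Qi geq_minl.
by case: ifP => // _; apply: leq_trans (geq_minr _ _) le_r.
Qed.

(** * The two sides of an edge of a tree *)

Section Tree.
Variables (n : nat) (adj : rel 'I_n).
Hypothesis Htree : is_tree adj.
Implicit Types (u v x y : 'I_n) (S : {set 'I_n}).

Lemma adj_irr : irreflexive adj. Proof. by case: Htree => -[]. Qed.

Lemma adj_sym : symmetric adj. Proof. by case: Htree => -[]. Qed.

Lemma adj_neq u v : adj u v -> u != v.
Proof. by apply: contraTneq => ->; rewrite adj_irr. Qed.

Lemma adj_connect x y : connect adj x y.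
Proof.
case: Htree => _ /forall_inP/(_ x (in_setT _))/forall_inP/(_ y (in_setT _)) cxy _.
by apply: connect_sub cxy => a b /= /and3P[_ _ ab]; apply: connect1.
Qed.

Lemma connect_inv (T : finType) (e : rel T) (Q : T -> Prop) (x y : T) :
  (forall a b, Q a -> e a b -> Q b) -> Q x -> connect e x y -> Q y.
Proof.
move=> eQ + /connectP[p + ->]; elim: p x => //= z p IHp x Qx /andP[exz].
exact/IHp/eQ/exz.
Qed.

Lemma mem_tedges u v : ([set u; v] \in tedges adj) = adj u v.
Proof.
apply/imsetP/idP => [[[a b]]|uv]; last by exists (u, v); rewrite ?inE.
rewrite inE /= => ab; have := adj_neq ab => neq_ab eq_uv.
have := set21 u v; have := set22 u v; have := set21 a b; have := set22 a b.
rewrite -{1 2}eq_uv {3 4}eq_uv !inE.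
by do 4![case/orP=> /eqP ?]; subst; rewrite ?eqxx // in neq_ab *; rewrite // adj_sym.
Qed.

Lemma tedgesP (e : {set 'I_n}) :
  reflect (exists u v, adj u v /\ e = [set u; v]) (e \in tedges adj).
Proof.
apply: (iffP imsetP) => [[[u v]]|[u [v [uv ->]]]]; last by exists (u, v); rewrite ?inE.
by rewrite inE /= => uv ->; exists u, v.
Qed.

(** The tree with the edge [uv] deleted. The order of [u] and [v] matters only for [side u v], the
    component at the head [v]. *)
Definition cut u v : rel 'I_n := fun x y => adj x y && ([set x; y] != [set u; v]).
Definition side u v : {set 'I_n} := [set x | connect (cut u v) v x].

Lemma cut_sym u v : symmetric (cut u v).
Proof. by move=> x y; rewrite /cut adj_sym setUC. Qed.

Lemma cutC u v : cut u v =2 cut v u.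
Proof. by move=> x y; rewrite /cut [[set u; v]]setUC. Qed.

Lemma side_id u v : v \in side u v.
Proof. by rewrite inE connect0. Qed.

(** A simple path from [v] to [u] avoiding the edge [uv] has length at least 2, so the edge closes
    it to a cycle. *)
Lemma side_notin u v : adj u v -> u \notin side u v.
Proof.
move=> uv; rewrite inE; apply/negP => /connectP[p0 /shortenP[p cut_p uniq_p _] last_p].
case: Htree => _ _ /(_ (v :: p)); rewrite uniq_p => nocycle.
suff : 2 < size (v :: p) /\ cycle adj (v :: p).
  by case=> szp cyc; move/(_ szp isT): nocycle; rewrite cyc.
split; last first.
  rewrite /= rcons_path -last_p uv andbT.
  by apply: sub_path cut_p => x y /andP[].
case: p cut_p last_p {uniq_p nocycle} => [|a [|b p]] //=.
  by move=> _ eq_uv; rewrite eq_uv adj_irr in uv.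
by move=> + eq_ua; rewrite /cut -eq_ua setUC eqxx !andbF.
Qed.

Lemma side_cut u v x y : x \in side u v -> cut u v x y -> y \in side u v.
Proof. by rewrite !inE => vx xy; apply: connect_trans vx (connect1 xy). Qed.

Lemma side_exit u v x y :
  adj u v -> adj x y -> x \in side u v -> y \notin side u v -> x = v /\ y = u.
Proof.
move=> uv xy xs yns.
have : [set x; y] == [set u; v].
  by apply: contraNT yns => neq; apply: side_cut xs _; rewrite /cut xy neq.
move=> /eqP eq_xy; have xuv : x \in [set u; v] by rewrite -eq_xy set21.
have yuv : y \in [set u; v] by rewrite -eq_xy set22.
case/set2P: xuv => xE; first by rewrite xE (negPf (side_notin uv)) in xs.
by case/set2P: yuv => yE //; rewrite yE side_id in yns.
Qed.

Lemma side_disjoint u v x : adj u v -> x \in side u v -> x \notin side v u.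
Proof.
move=> uv xs; apply/negP; rewrite inE => ux; case/negP: (side_notin uv).
rewrite !inE in xs *; apply: connect_trans xs _.
rewrite (sym_connect_sym (@cut_sym u v)).
by rewrite (eq_connect (@cutC u v)).
Qed.

Lemma side_cover u v x : adj u v -> (x \in side u v) || (x \in side v u).
Proof.
move=> uv.
apply: (@connect_inv _ adj (fun x => (x \in side u v) || (x \in side v u)) v x);
    last first.
- exact: adj_connect.
- by rewrite side_id.
move=> a b ab_s ab.
have [bs|bns] := boolP (b \in side u v) => //=.
have [bs|bns'] := boolP (b \in side v u) => //=.
have vu : adj v u by rewrite adj_sym.
case/orP: ab_s => sa.
  by have [_ bE] := side_exit uv ab sa bns; rewrite bE side_id in bns'.
by have [_ bE] := side_exit vu ab sa bns'; rewrite bE side_id in bns.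
Qed.

Lemma side_connected_on u v S x :
  adj u v -> connected_on adj S -> ~~ ([set u; v] \subset S) ->
  x \in S -> x \in side u v -> S \subset side u v.
Proof.
move=> uv Sconn nuvS xS xs; apply/subsetP => y yS.
have := forall_inP (forall_inP Sconn x xS) y yS.
apply: (connect_inv (Q := fun z => z \in side u v)) xs => a b sa /= /and3P[aS bS ab].
apply: side_cut sa _; rewrite /cut ab; apply: contraNneq nuvS => <-.
by apply/subsetP => z /set2P[->|->].
Qed.

Lemma side_neighbor v x : x != v -> exists2 u, adj v u & x \in side v u.
Proof.
move=> neq_xv; have /connectP[p0 /shortenP[p adj_p uniq_p _]] := adj_connect v x.
case: p adj_p uniq_p => [_ _ xE|u p]; first by rewrite xE eqxx in neq_xv.
rewrite [path _ _ _]/= => /andP[vu adj_p] uniq_p xE; exists u => //.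
rewrite inE; apply/connectP; exists p => //.
rewrite cons_uniq in uniq_p; case/andP: uniq_p => v_p _.
apply: (@sub_in_path _ [pred z | z != v] adj (cut v u)) adj_p.
- move=> y z; rewrite !inE => yv zv yz; rewrite /cut yz /=.
  by apply/eqP => eq_yz; have := set21 v u;
      rewrite -eq_yz !inE !(eq_sym v) (negPf yv) (negPf zv).
- by apply/allP => z zp; rewrite inE; apply: contraNneq v_p => <-.
Qed.

(** A path leaves the side only from [v] to [u] and can return only through [v], which a simple path
    does not revisit. *)
Lemma side_convex u v x p : adj u v -> path adj x p -> uniq (x :: p) ->
  x \in side u v -> last x p \in side u v -> {subset x :: p <= side u v}.
Proof.
move=> uv; elim: p x => [|y p IHp] x /=.
  by move=> _ _ xs _ z; rewrite inE => /eqP->.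
move=> /andP[xy adj_p] /andP[x_p uniq_p] xs last_s.
have [ys|yns] := boolP (y \in side u v).
  move=> z; rewrite inE => /orP[/eqP->//|]; exact: IHp.
have [xE yE] := side_exit uv xy xs yns.
have outside q z : path adj z q -> v \notin z :: q -> z \notin side u v ->
    last z q \notin side u v.
  elim: q z => //= a q IHq z /andP[za adj_q]; rewrite inE negb_or => /andP[vz vq] zns.
  apply: IHq => //; apply/negP => sa; rewrite adj_sym in za.
  have [aE _] := side_exit uv za sa zns.
  by rewrite aE mem_head in vq.
by rewrite xE in x_p; have := outside _ _ adj_p x_p yns; rewrite last_s.
Qed.

(** Distinct branches at [v] are disjoint: a walk from [u'] could enter the branch of [u] only from
    [v], which lies outside the branch of [u']. *)
Lemma side_uniq v u u' x : adj v u -> adj v u' ->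
  x \in side v u -> x \in side v u' -> u = u'.
Proof.
move=> vu vu' xs xs'; apply/eqP; apply: contraTT xs => neq_uu'.
suff : (x \in side v u') && (x \notin side v u) by case/andP.
move: xs'; rewrite {1}inE; apply: (connect_inv
  (Q := fun z => (z \in side v u') && (z \notin side v u))) => [a b|]; last first.
  rewrite side_id; apply/negP => s'; have u'v : adj u' v by rewrite adj_sym.
  have [u'E _] := side_exit vu u'v s' (side_notin vu).
  by rewrite u'E eqxx in neq_uu'.
case/andP=> sa nsa ab; rewrite (side_cut sa ab) /=; apply/negP => sb.
have ba : adj b a by case/andP: ab; rewrite adj_sym.
have [_ aE] := side_exit vu ba sb nsa.
by rewrite aE (negPf (side_notin vu')) in sa.
Qed.

(** * Steiner trees as intersections of sides, and the count of their edges *)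

Definition hull (A : {set 'I_n}) : {set 'I_n} :=
  [set x | [forall u, forall v, adj u v && (A \subset side u v) ==> (x \in side u v)]].

Lemma hullP (A : {set 'I_n}) x :
  reflect (forall u v, adj u v -> A \subset side u v -> x \in side u v) (x \in hull A).
Proof.
rewrite inE; apply: (iffP forallP) => [H u v uv sA|H u].
  by have /forallP/(_ v) := H u; rewrite uv sA.
by apply/forallP => v; apply/implyP => /andP[]; apply: H.
Qed.

Lemma sub_hull (A : {set 'I_n}) : A \subset hull A.
Proof. by apply/subsetP => x xA; apply/hullP => u v _ /subsetP/(_ x xA). Qed.

(** Sides are closed under simple paths, hence so is their intersection. *)
Lemma hull_connected (A : {set 'I_n}) : connected_on adj (hull A).
Proof.
apply/forall_inP => x xH; apply/forall_inP => y yH.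
have /connectP[p0 /shortenP[p adj_p uniq_p _] yE] := adj_connect x y.
have pH : {subset x :: p <= hull A}.
  move=> z zp; apply/hullP => u v uv sA.
  by apply: (side_convex uv adj_p uniq_p) zp; [apply: (hullP _ _ xH) | rewrite -yE;
      apply: (hullP _ _ yH)].
apply/connectP; exists p => //.
apply: (@sub_in_path _ (mem (hull A)) adj) adj_p; last by apply/allP.
by move=> a b aH bH ab /=; apply/and3P.
Qed.

(** The oriented edges pointing towards [A]. For nonempty [A] they correspond to the tree edges
    outside its Steiner tree, one orientation each. *)
Definition separating (A : {set 'I_n}) : {set 'I_n * 'I_n} :=
  [set d | adj d.1 d.2 && (A \subset side d.1 d.2)].

(** A connected [S] not containing an edge lies on one side of it, so one orientation of that edge
    separates. *)
Lemma tedges_le (A S : {set 'I_n}) : A != set0 -> A \subset S -> connected_on adj S ->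
  #|tedges adj| <= #|[set e in tedges adj | e \subset S]| + #|separating A|.
Proof.
move=> /set0Pn[x xA] AS Sconn.
rewrite -(cardsID [set e : {set 'I_n} | e \subset S] (tedges adj)) leq_add //.
  by apply: subset_leq_card; apply/subsetP => e; rewrite !inE.
apply: leq_trans (leq_imset_card (fun d => [set d.1; d.2]) (separating A)).
apply: subset_leq_card; apply/subsetP => e; rewrite !inE =>
    /andP[eS /tedgesP[u [v [uv eE]]]].
rewrite {}eE in eS *; have xS := subsetP AS x xA.
case/orP: (side_cover x uv) => xs; apply/imsetP.
  exists (u, v) => //; rewrite inE /= uv /=.
  exact: subset_trans AS (side_connected_on uv Sconn eS xS xs).
have vu : adj v u by rewrite adj_sym.
exists (v, u) => /=; last by rewrite setUC.
rewrite inE /= vu /=; rewrite setUC in eS.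
exact: subset_trans AS (side_connected_on vu Sconn eS xS xs).
Qed.

(** The tail of a separating edge is outside the hull. As [A] is nonempty and opposite sides are
    disjoint, only one orientation of an edge can separate. *)
Lemma tedges_hull (A : {set 'I_n}) : A != set0 ->
  #|[set e in tedges adj | e \subset hull A]| + #|separating A| <= #|tedges adj|.
Proof.
move=> /set0Pn[x xA].
rewrite -(cardsID [set e : {set 'I_n} | e \subset hull A] (tedges adj)) leq_add //.
  by apply: subset_leq_card; apply/subsetP => e; rewrite !inE.
rewrite -(@card_in_imset _ _ (fun d => [set d.1; d.2]) (separating A)).
  apply: subset_leq_card; apply/subsetP => e /imsetP[[u v]]; rewrite inE /= =>
      /andP[uv sA] ->.
  rewrite !inE mem_tedges uv andbT; apply/negP =>
      /subsetP/(_ u (set21 u v))/hullP/(_ u v uv sA).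
  by rewrite (negPf (side_notin uv)).
move=> [u v] [a b]; rewrite !inE /= => /andP[uv sA] /andP[ab sA'] eq_e.
have xs := subsetP sA x xA; have xs' := subsetP sA' x xA.
have : u \in [set a; b] by rewrite -eq_e set21.
have : v \in [set a; b] by rewrite -eq_e set22.
have neq_uv := adj_neq uv.
case/set2P=> vE /set2P[] uE; rewrite {}vE {}uE in uv xs neq_uv *;
    rewrite ?eqxx // in neq_uv.
by rewrite (negPf (side_disjoint ab xs')) in xs.
Qed.

(** Root the tree at [r] and match each other vertex with the edge to its parent. Two vertices that
    are each other's parent would put [r] on both sides of an edge. *)
Lemma card_tedges (r : 'I_n) : #|tedges adj| = n.-1.
Proof.
pose par v := odflt v [pick u | adj v u && (r \in side v u)].
have parP v : v != r -> adj v (par v) /\ r \in side v (par v).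
  move=> neq_vr; rewrite /par; case: pickP => [u /andP[]//|nopick].
  have [u vu rs] : exists2 u, adj v u & r \in side v u.
    by apply: side_neighbor; rewrite eq_sym.
  by have := nopick u; rewrite vu rs.
have par_eq u v : adj v u -> r \in side v u -> v != r /\ par v = u.
  move=> vu rs; have neq_vr : v != r.
    by apply: contraTneq rs => <-; apply: side_notin.
  by split=> //; have [vp rp] := parP v neq_vr; apply: side_uniq vp vu rp rs.
have -> : tedges adj = [set [set v; par v] | v in [set~ r]].
  apply/setP => e; apply/tedgesP/imsetP => [[u [v [uv ->]]]|[v]]; last first.
    by rewrite !inE => /parP[vp _] ->; exists v, (par v).
  have vu : adj v u by rewrite adj_sym.
  case/orP: (side_cover r uv) => rs.
    by have [neq <-] := par_eq _ _ uv rs; exists u; rewrite ?inE.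
  by have [neq <-] := par_eq _ _ vu rs; exists v; rewrite ?inE // setUC.
rewrite card_in_imset ?cardsC1 ?card_ord // => v w; rewrite !inE => neq_vr neq_wr eq_e.
have [vp rv] := parP v neq_vr; have [wp rw] := parP w neq_wr.
have /set2P[//|vE] : v \in [set w; par w] by rewrite -eq_e set21.
have /set2P[//|wE] : w \in [set v; par v] by rewrite eq_e set21.
by rewrite -vE in rw wp; rewrite -wE in rv; rewrite (negPf (side_disjoint wp rw)) in rv.
Qed.

Lemma steiner2_separating (A B : {set 'I_n}) : A :|: B != set0 ->
  steiner2 adj A B + #|separating (A :|: B)| = #|tedges adj|.
Proof.
move=> AB0; apply/eqP; rewrite eqn_leq; apply/andP; split.
  apply: leq_trans (tedges_hull AB0); rewrite leq_add2r /steiner2.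
  by apply: geq_bigmin; rewrite sub_hull hull_connected.
rewrite /steiner2; elim/big_ind: _ => [|a b ha hb|S /andP[ABS Sconn]].
(* The default value [n] of the minimum exceeds the number [n.-1] of edges, so it respects the lower
   bound. *)
- have /set0Pn[r _] := AB0; rewrite (card_tedges r).
  by apply: leq_trans (leq_pred n) (leq_addr _ _).
- by rewrite addn_minl leq_min ha.
- exact: tedges_le.
Qed.

Lemma steiner2_edge_gt0 (A B e : {set 'I_n}) :
  e \in tedges adj -> e \subset A :|: B -> 0 < steiner2 adj A B.
Proof.
move=> eE eAB; rewrite /steiner2; elim/big_ind: _ => [|a b ha hb|S /andP[ABS _]].
- by case/tedgesP: eE => u _; apply: leq_ltn_trans (ltn_ord u).
- by rewrite leq_min ha.
- by apply/card_gt0P; exists e; rewrite !inE eE (subset_trans eAB).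
Qed.

(** * Stars of vertices as blocks of the line graph *)

Definition star v : {set {set 'I_n}} := [set e in tedges adj | v \in e].

Lemma starP v e : reflect (exists2 u, adj v u & e = [set v; u]) (e \in star v).
Proof.
rewrite inE; apply: (iffP andP) => [[/tedgesP[a [b [ab ->]]] /set2P[->|->]]|[u vu ->]].
- by exists b.
- by exists a; rewrite ?[adj b a]adj_sym // setUC.
- by rewrite mem_tedges set21.
Qed.

(** Edges through [v] pairwise meet, so every subset of the star is a clique; this gives both
    connectedness and the absence of cut vertices. *)
Lemma sub_star_connected v (S : {set {set 'I_n}}) :
  S \subset star v -> connected_on (lgraph adj) S.
Proof.
move=> /subsetP sS; apply/forall_inP => e eS; apply/forall_inP => f fS.
have [->|neq_ef] := eqVneq e f; first exact: connect0.
apply: connect1; rewrite /= eS fS /lgraph neq_ef.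
have := sS e eS; have := sS f fS; rewrite !inE => /andP[-> vf] /andP[-> ve] /=.
by apply/set0Pn; exists v; rewrite inE ve.
Qed.

Lemma star_gt1 v : 1 < #|[set u | adj v u]| -> 1 < #|star v|.
Proof.
move=> /card_gt1P[a [b [va vb neq_ab]]]; rewrite !inE in va vb.
apply/card_gt1P; exists [set v; a], [set v; b]; split.
- by apply/starP; exists a.
- by apply/starP; exists b.
apply: contraNneq neq_ab => eq_e; have : a \in [set v; b] by rewrite -eq_e set22.
by case/set2P=> [aE|->//]; rewrite aE adj_irr in va.
Qed.

(** For maximality, suppose a larger [S] contains an edge [e] missing [v]. It lies in one branch
    [side v u], and removing the edge [vu] from [S] disconnects [e] from any other edge at [v]. *)
Lemma star_is_block v :
  1 < #|[set u | adj v u]| -> is_block (tedges adj) (lgraph adj) (star v).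
Proof.
move=> deg_v; have star1 := star_gt1 deg_v.
apply/andP; split.
  rewrite /conn_nocut (sub_star_connected (subxx _)) -card_gt0 (ltnW star1) /=.
  apply/andP; split; first by apply/subsetP => e; rewrite inE => /andP[].
  by apply/forall_inP => e _; apply: (@sub_star_connected v); apply: subsetDl.
apply/forallP => S; apply/implyP => /andP[starS /and4P[S_edges _ _ S_nocut]].
rewrite eqEsubset starS andbT; apply/subsetP => e eS; rewrite inE (subsetP S_edges) //=.
apply/negPn/negP => v_e.
have /tedgesP[a [b [ab eE]]] := subsetP S_edges e eS.
have av : a != v by apply: contraNneq v_e => <-; rewrite eE set21.
have bv : b != v by apply: contraNneq v_e => <-; rewrite eE set22.
have [u vu au] := side_neighbor av.
have bu : b \in side v u.
  by apply: contraNT bv => bns; have [_ ->] := side_exit vu ab au bns.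
have e_side : e \subset side v u by rewrite eE; apply/subsetP => z /set2P[]->.
have /card_gt1P[c [d [vc vd neq_cd]]] := deg_v; rewrite !inE in vc vd.
have [u' vu' neq_u'u] : exists2 u', adj v u' & u' != u.
  by have [cu|] := eqVneq c u; [exists d; rewrite // -cu eq_sym | exists c].
have gS : [set v; u] \in S by apply: (subsetP starS); apply/starP; exists u.
have g'S : [set v; u'] \in S by apply: (subsetP starS); apply/starP; exists u'.
have neq_g'g : [set v; u'] != [set v; u].
  apply: contraNneq neq_u'u => eq_g; have : u' \in [set v; u] by rewrite -eq_g set22.
  by case/set2P=> [u'E|->//]; rewrite u'E adj_irr in vu'.
have neq_eg : e != [set v; u] by apply: contraNneq v_e => ->; rewrite set21.
have := forall_inP S_nocut _ gS => /forall_inP/(_ e).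
rewrite !inE neq_eg => /(_ eS)/forall_inP/(_ [set v; u']).
rewrite !inE neq_g'g => /(_ g'S) conn.
suff /subsetP/(_ v (set21 v u')) : [set v; u'] \subset side v u.
  by rewrite (negPf (side_notin vu)).
(* A walk in the line graph that avoids [vu] stays inside the branch, since [vu] is the only edge
   leaving it. *)
apply: (connect_inv (Q := fun f : {set 'I_n} => f \subset side v u)) e_side conn.
move=> f h f_side /= /and3P[_]; rewrite !inE =>
    /andP[h_neq _] /and4P[_ hE _ /set0Pn[z]].
rewrite inE => /andP[zf zh].
have /tedgesP[x [y [xy hxy]]] := hE; rewrite {}hxy in h_neq zh *.
wlog zE : x y xy h_neq zh / z = x.
  move=> wl; case/set2P: (zh) => zE; first exact: wl.
  by rewrite setUC in h_neq zh *; apply: wl => //; rewrite adj_sym.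
have xs : x \in side v u by rewrite -zE (subsetP f_side).
suff ys : y \in side v u by apply/subsetP => t /set2P[]->.
apply: contraNT h_neq => yns; have [-> ->] := side_exit vu xy xs yns.
by rewrite setUC.
Qed.

Lemma symdiff_star v e f : e \in star v -> f \in star v -> e != f ->
  exists a b, [/\ adj v a, adj v b, a != b & symdiff e f = [set a; b]].
Proof.
move=> /starP[a va ->] /starP[b vb ->] neq_ef; exists a, b.
have neq_ab : a != b by apply: contraNneq neq_ef => ->.
split=> //; apply/setP => z; rewrite !inE.
have := adj_neq va; have := adj_neq vb.
have [->|zv] := eqVneq z v; first by move=> /negPf-> /negPf->.
by have [->|za] := eqVneq z a; rewrite ?(negPf neq_ab) //=; case: (z == b).
Qed.

(** Keeps the pairs [f_j] apart from the edges of the tree. *)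
Lemma no_triangle a b v : adj v a -> adj v b -> a != b -> ~~ adj a b.
Proof.
move=> va vb neq_ab; apply/negP => ab.
case: Htree => _ _ /(_ [:: v; a; b] isT) /=.
by rewrite !inE va ab [adj b v]adj_sym vb (negPf neq_ab) negb_or !adj_neq // =>
    /(_ isT).
Qed.

(** Lets a pair [f_j] determine the centre of its star. *)
Lemma no_square a b v w : adj v a -> adj v b -> adj w a -> adj w b -> a != b -> v = w.
Proof.
move=> va vb wa wb neq_ab; apply/eqP/negPn/negP => neq_vw.
case: Htree => _ _ /(_ [:: v; a; w; b] isT) /=.
rewrite !inE va wb [adj a w]adj_sym [adj b v]adj_sym wa vb (negPf neq_ab) !negb_or.
by rewrite neq_vw [a == w]eq_sym !adj_neq // => /(_ isT).
Qed.

(** With at least two vertices none is isolated, so a non-leaf has degree at least 2. *)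
Lemma card_not_leaves : 1 < n ->
  nleaves adj + #|[set v | 1 < #|[set u | adj v u]|]| = n.
Proof.
move=> n_gt1;
    rewrite /nleaves -[RHS]card_ord -(cardsC [set v | #|[set u | adj v u]| == 1]).
congr (_ + #|pred_of_set _|); apply/setP => v; rewrite !inE.
have /card_gt0P[x neq_xv] : 0 < #|predC1 v| by rewrite cardC1 card_ord; lia.
have [u vu _] := side_neighbor neq_xv.
have : 0 < #|[set u | adj v u]| by apply/card_gt0P; exists u; rewrite inE.
by case: #|_| => [|[|k]].
Qed.

(** * Size, trace and decomposition of the Steiner matrix on [B] *)

Section Basis.
Variable pick : {set {set 'I_n}} -> {set 'I_n} * {set 'I_n}.
Hypothesis Hpick : forall Bk : {set {set 'I_n}},
  is_block (tedges adj) (lgraph adj) Bk -> 1 < #|Bk| ->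
  [/\ (pick Bk).1 \in Bk, (pick Bk).2 \in Bk & lgraph adj (pick Bk).1 (pick Bk).2].
Let blocks := [set Bk : {set {set 'I_n}} |
                 is_block (tedges adj) (lgraph adj) Bk && (1 < #|Bk|)].
Let B := tedges adj :|: [set symdiff (pick Bk).1 (pick Bk).2 | Bk in blocks].

Lemma basis_neq0 b : b \in B -> b != set0.
Proof.
rewrite inE => /orP[/tedgesP[u [v [_ ->]]]|/imsetP[Bk]].
  by apply/set0Pn; exists u; rewrite set21.
rewrite inE => /andP[Bk_block Bk_gt1] ->.
have [_ _ /and4P[_ _ + _]] := Hpick Bk_block Bk_gt1.
apply: contraNneq => /setP sd0; apply/eqP/setP => x.
by have := sd0 x; rewrite !inE; case: (x \in _); case: (x \in _).
Qed.

(** The n - 1 edges and the n - p pairs from stars of non-leaf vertices are all distinct members of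
    [B]. *)
Lemma card_basis : 1 < n -> 2 * n - nleaves adj - 1 <= #|B|.
Proof.
move=> n_gt1; have r : 'I_n by exists 0; apply: ltnW.
pose inner := [set v | 1 < #|[set u | adj v u]|].
pose f v := symdiff (pick (star v)).1 (pick (star v)).2.
have fP v : v \in inner ->
    exists a b, [/\ adj v a, adj v b, a != b & f v = [set a; b]].
  rewrite inE => deg_v.
  have [p1 p2 /and4P[_ _ neq _]] := Hpick (star_is_block deg_v) (star_gt1 deg_v).
  exact: symdiff_star.
have f_inj : {in inner &, injective f}.
  move=> v w /fP[a [b [va vb neq_ab ->]]] /fP[c [d [wc wd neq_cd ->]]] eq_f.
  have nbr x : x \in [set a; b] -> adj w x by rewrite eq_f => /set2P[]->.
  by apply: (no_square va vb) neq_ab; apply: nbr; rewrite ?set21 ?set22.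
have sub_B : tedges adj :|: [set f v | v in inner] \subset B.
  apply: setUS; apply/subsetP => _ /imsetP[v v_inner ->]; rewrite inE in v_inner.
  by apply/imsetP; exists (star v); rewrite // inE star_is_block // star_gt1.
apply: leq_trans (subset_leq_card sub_B); rewrite cardsU (card_in_imset f_inj).
have -> : tedges adj :&: [set f v | v in inner] = set0.
  apply/setP => e; rewrite !inE; apply/andP =>
      -[+ /imsetP[v /fP[a [b [va vb neq_ab ->]]] eE]].
  by rewrite eE mem_tedges (negPf (no_triangle va vb neq_ab)).
rewrite cards0 subn0 (card_tedges r) -/inner.
by have := card_not_leaves n_gt1; rewrite -/inner; lia.
Qed.

Lemma steiner_sub_trace_gt0 : 1 < n -> (0 < \tr (steiner_sub adj B))%R.
Proof.
move=> n_gt1.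
have /card_gt0P[e e_edge] : 0 < #|tedges adj|.
  by rewrite (card_tedges (Ordinal (ltnW n_gt1))) -subn1 subn_gt0.
have eB : e \in B by rewrite inE e_edge.
rewrite /mxtrace (bigD1 (enum_rank_in eB e)) //= ltr_wpDr //.
  by apply: sumr_ge0 => i _; rewrite mxE.
by rewrite mxE enum_rankK_in // ltz_nat (steiner2_edge_gt0 e_edge) // setUid.
Qed.

(** A union lies in a side exactly when both sets do, so the indicator of [separating] factors into
    a product. *)
Lemma steiner_sub_rank1 (i j : 'I_#|B|) :
  (steiner_sub adj B i j = (#|tedges adj|)%:Z
    - \sum_(d : 'I_n * 'I_n)
        (adj d.1 d.2 && (enum_val i \subset side d.1 d.2))%:Z
        * (adj d.1 d.2 && (enum_val j \subset side d.1 d.2))%:Z)%R.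
Proof.
have ij0 : enum_val i :|: enum_val j != set0.
  by rewrite setU_eq0 negb_and basis_neq0 ?enum_valP.
rewrite mxE -(steiner2_separating ij0) PoszD; apply/eqP; rewrite eq_sym.
rewrite subr_eq; apply/eqP; congr (_ + _)%R.
rewrite -natz -sum1_card natr_sum big_mkcond /=; apply: eq_bigr => d _.
by rewrite inE subUset; case: (adj _ _); case: (_ \subset _); case: (_ \subset _).
Qed.

End Basis.
End Tree.

Theorem theorem1p5 (n : nat) (adj : rel 'I_n) (Htree : is_tree adj)
  (pick : {set {set 'I_n}} -> {set 'I_n} * {set 'I_n})
  (Hpick : forall Bk : {set {set 'I_n}},
      is_block (tedges adj) (lgraph adj) Bk -> 1 < #|Bk| ->
      [/\ (pick Bk).1 \in Bk, (pick Bk).2 \in Bk & lgraph adj (pick Bk).1 (pick Bk).2]) :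
  let blocks := [set Bk : {set {set 'I_n}} |
                   is_block (tedges adj) (lgraph adj) Bk && (1 < #|Bk|)] in
  let B := tedges adj :|: [set symdiff (pick Bk).1 (pick Bk).2 | Bk in blocks] in
  let P := steiner_sub adj B in
  let p := nleaves adj in
  let s := [seq absz ((char_poly P)`_k)%R | k <- iota 0 (2 * n - p - 1)] in
  unimodal s /\ log_concave s.
Proof.
move=> blocks B P p s.
(* For [n <= 1] the list has at most one term and both claims are immediate. *)
have [n_le1|n_gt1] := leqP n 1; last first.
  apply: (char_poly_coef_log_concave (steiner_sub_rank1 Htree Hpick)).
    exact: steiner_sub_trace_gt0.
  exact: card_basis.
have size_s : size s <= 1 by rewrite size_map size_iota; lia.
split=> [|i i_gt0 lt_is]; last lia.
exists 0 => i j /andP[le_ij lt_js].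
have i0 : i = 0 by lia.
have j0 : j = 0 by lia.
by rewrite i0 j0.
Qed.
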